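(* Let $K\ge 1$ and $0\le v_1<v_2<\cdots<v_K$, and let the edge weights be i.i.d. uniform on $\{v_1,\dots,v_K\}$, i.e. $p_1=\cdots=p_K=\frac1K$. Let $G$ be the linear network (path) with $n$ users. Then the average performance ratio of Algorithm 1 (greedy matching) satisfies $$\lim_{n\to\infty}PR(G)\;\ge\;\frac{\sum_{k=1}^{K}v_k\,\frac{(K-1)^{K-k}}{(K+1)^{K-k+1}}}{\sum_{k=1}^{K}v_k\,\frac{K}{(2K+1-k)(2K-k)}}\;\ge\;1-\Big(\frac{K-1}{K+1}\Big)^{K}\;\ge\;1-e^{-2}\approx 86.5\%,$$ where the second inequality becomes an equality in the limit when all the possible weight values become similar, i.e. $\frac{v_K}{v_1}\to1^+$.
   Context: Linear network: users $u_1,\dots,u_n$, edges $e_i=\{u_i,u_{i+1}\}$ for $i=1,\dots,n-1$, with weight $w_i$ on $e_i$; $W=(w_1,\dots,w_{n-1})$. The weights are i.i.d. with $\Pr(w_i=v_k)=p_k$, $\sum_k p_k=1$; $K$, the $v_k$ and the $p_k$ are fixed as $n\to\infty$. Algorithm 1 (greedy matching): initially all users are unmatched. Each iteration has two phases. Proposal phase: every unmatched user having at least one unmatched neighbor sends a proposal to the unmatched neighbor to which it is joined by the edge of largest weight; on the linear network, if its two edges have the same weight, the left neighbor $u_{i-1}$ of $u_i$ has priority. Matching phase: every pair of users that proposed to each other is matched and becomes unavailable to others. The algorithm stops when no unmatched user has an unmatched neighbor. $\hat f(G,W)$ is the total weight of the matching returned by Algorithm 1, $f^\star(G,W)$ is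 the maximum total weight of a matching of $(G,W)$, and the average performance ratio is $PR(G)=\mathbb{E}_W[\hat f(G,W)]/\mathbb{E}_W[f^\star(G,W)]$. *)

(* Defs.v *)
(* MathComp. *)
From HB Require Import structures.
From mathcomp Require Import all_boot all_order all_algebra.

Set Implicit Arguments.
Unset Strict Implicit.
Unset Printing Implicit Defensive.

Import Order.TTheory GRing.Theory Num.Theory.

Local Open Scope ring_scope.

Section Matching.
Variables (R : realDomainType) (n : nat).
Variables (adj : rel 'I_n) (wt : 'I_n -> 'I_n -> R).

(* The edge {u, v} with u < v is encoded by the pair (u, v). *)
Definition is_matching (M : {set 'I_n * 'I_n}) : bool :=
  [forall e in M, (e.1 < e.2)%N && adj e.1 e.2] &&
  [forall e in M, forall f in M,
     (e != f) ==> [disjoint [set e.1; e.2] & [set f.1; f.2]]].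

Definition matching_weight (M : {set 'I_n * 'I_n}) : R :=
  \sum_(e in M) wt e.1 e.2.

(* The default value 0 is the weight of the empty matching. *)
Definition fstar : R :=
  \big[Num.max/0]_(M : {set 'I_n * 'I_n} | is_matching M) matching_weight M.

Definition unmatched (M : {set 'I_n * 'I_n}) : {set 'I_n} :=
  [set u | [forall e in M, (u != e.1) && (u != e.2)]].

(* Among equally weighted candidates, the neighbor of least index has
   priority; on a path this is the left neighbor. *)
Definition proposes (U : {set 'I_n}) (u v : 'I_n) : bool :=
  [&& u \in U, v \in U, adj u v &
    [forall x in U, adj u x ==>
       ((wt u x < wt u v) || ((wt u x == wt u v) && (v <= x)%N))]].

Definition greedy_step (M : {set 'I_n * 'I_n}) : {set 'I_n * 'I_n} :=
  M :|: [set e : 'I_n * 'I_n | [&& (e.1 < e.2)%N, proposes (unmatched M) e.1 e.2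
                   & proposes (unmatched M) e.2 e.1]].

(* Once no unmatched user has an unmatched neighbor, [greedy_step] is the
   identity, and until then each iteration matches at least one new pair: n
   iterations reach the final state (see [greedy_stops]). *)
Definition greedy : {set 'I_n * 'I_n} := iter n greedy_step set0.

Definition fhat : R := matching_weight greedy.

Lemma unmatched_step M : irreflexive adj -> symmetric adj ->
  (forall u v, wt u v = wt v u) ->
  forall u v, u \in unmatched M -> v \in unmatched M -> adj u v ->
  unmatched (greedy_step M) \proper unmatched M.
Proof.
move=> adjI adjC wtC u v; set U := unmatched M => uU vU uv.
pose av (e : 'I_n * 'I_n) := [&& e.1 \in U, e.2 \in U & adj e.1 e.2].
have av0 : av (u, v) by rewrite /av /= uU vU.
case: (Order.TotalTheory.arg_maxP (fun e => wt e.1 e.2) av0) => m mav mmax.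
pose best (e : 'I_n * 'I_n) := av e && (wt e.1 e.2 == wt m.1 m.2).
pose ba a := [exists b, best (a, b)].
have ba0 : ba m.1.
  by apply/existsP; exists m.2; rewrite /best -surjective_pairing mav eqxx.
case: (arg_minnP (fun a : 'I_n => val a) ba0) => a /existsP[b0 ab0] amin.
case: (arg_minnP (P := fun b => best (a, b)) (fun b : 'I_n => val b) ab0).
move=> b /andP[/and3P[/= aU bU ab] /eqP wab] bmin {b0 ab0}.
have pab : proposes U a b.
  apply/and4P; split=> //; apply/forall_inP => x xU; apply/implyP => ax.
  have xav : av (a, x) by rewrite /av /= aU xU.
  have := mmax _ xav; rewrite /= -wab le_eqVlt => /orP[/eqP e|->] //.
  by rewrite e eqxx bmin ?orbT // /best xav /= e wab eqxx.
have pba : proposes U b a.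
  apply/and4P; split; rewrite // 1?adjC //.
  apply/forall_inP => x xU; apply/implyP; rewrite adjC => xb.
  have xav : av (x, b) by rewrite /av /= xU bU.
  have := mmax _ xav; rewrite /= -wab (wtC b x) (wtC b a) le_eqVlt.
  move=> /orP[/eqP e|->] //.
  rewrite e eqxx amin ?orbT //; apply/existsP; exists b.
  by rewrite /best xav /= e wab eqxx.
apply/properP; split.
  apply/subsetP => x; rewrite !inE => /forall_inP h; apply/forall_inP => e eM.
  by apply: h; rewrite inE eM.
have [ltab|ltba|eab] := ltngtP a b.
- exists a => //; rewrite inE; apply/negP => /forall_inP/(_ (a, b)).
  by rewrite !inE /= ltab pab pba orbT eqxx => /(_ isT).
- exists a => //; rewrite inE; apply/negP => /forall_inP/(_ (b, a)).
  by rewrite !inE /= ltba pab pba orbT eqxx andbF => /(_ isT).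
- by move: ab; rewrite (val_inj eab) adjI.
Qed.

Lemma greedy_stops : irreflexive adj -> symmetric adj ->
  (forall u v, wt u v = wt v u) ->
  {in unmatched greedy &, forall u v, ~~ adj u v}.
Proof.
move=> adjI adjC wtC.
pose stop M := [forall u in unmatched M, forall v in unmatched M, ~~ adj u v].
have stopP M : ~~ stop M -> unmatched (greedy_step M) \proper unmatched M.
  case/forall_inPn => u uU /forall_inPn[v vU] /negPn uv.
  exact: unmatched_step uU vU uv.
have sub M : unmatched (greedy_step M) \subset unmatched M.
  apply/subsetP => x; rewrite !inE => /forall_inP h; apply/forall_inP => e eM.
  by apply: h; rewrite inE eM.
have : stop greedy.
  suff H k : stop (iter k greedy_step set0) ||
             (#|unmatched (iter k greedy_step set0)| + k <= n)%N.
    have /orP[//|] := H n; rewrite -[X in (_ <= X)%N -> _]add0n leq_add2r leqn0.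
    by move=> /eqP/card0_eq U0; apply/forall_inP => u; rewrite U0.
  elim: k => [|k /= IH].
    by rewrite addn0 -[X in (_ <= X)%N]card_ord max_card orbT.
  move: IH; set M := iter k _ _; have [sM _|nM /= le] := boolP (stop M).
    apply/orP; left; apply/forall_inP => u /(subsetP (sub M)) uU.
    apply/forall_inP => v /(subsetP (sub M)) vU.
    exact: (forall_inP (forall_inP sM u uU) v vU).
  by rewrite addnS (leq_trans _ le) ?orbT // ltn_add2r proper_card ?stopP.
by move=> /forall_inP h u v uU vU; exact: (forall_inP (h u uU) v vU).
Qed.

End Matching.

Definition path_adj (n : nat) : rel 'I_n :=
  fun u v => (u.+1 == v :> nat) || (v.+1 == u :> nat).

(* Users are numbered from 0; W`_i is the weight of the edge {i, i+1}. *)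
Definition path_wt (R : realDomainType) (n : nat) (W : seq R) (u v : 'I_n) : R :=
  W`_(minn u v).

(* Expectation of f(w_1, ..., w_m) for independent w_i with
   Pr(w_i = v k) = p k, 1 <= k <= K; the outcome j : 'I_K of a draw stands
   for the value v j.+1. *)
Definition iid_expectation (R : realFieldType) (K : nat) (v p : nat -> R)
    (m : nat) (f : seq R -> R) : R :=
  \sum_(W : m.-tuple 'I_K)
    (\prod_(j <- W) p j.+1) * f [seq v (j : 'I_K).+1 | j <- W].

Definition path_PR (R : realFieldType) (K : nat) (v p : nat -> R) (n : nat) : R :=
  iid_expectation K v p n.-1 (fun W => fhat (@path_adj n) (path_wt W)) /
  iid_expectation K v p n.-1 (fun W => fstar (@path_adj n) (path_wt W)).

Definition PR_bound (R : realFieldType) (K : nat) (v : nat -> R) : R :=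
  (\sum_(1 <= k < K.+1)
      v k * ((K%:R - 1) ^+ (K - k) / (K%:R + 1) ^+ (K - k + 1))) /
  (\sum_(1 <= k < K.+1)
      v k * (K%:R / ((2 * K%:R + 1 - k%:R) * (2 * K%:R - k%:R)))).

(* Main.v *)
(* With ties broken in favor of the left edge, an edge of the path is matched by
   the greedy algorithm iff it is blocked neither from the left nor from the
   right, where an edge is blocked from one side iff its neighbor on that side
   outranks it and is itself not blocked from that side.  Given the
   weight of the edge, the two events are independent, and their probabilities
   obey linear recursions on the distance to the ends of the path; this gives
   the exact limit of E[fhat] / n, which is the numerator of the bound.
   The limit of E[fstar] / n exists by subadditivity.  Writing each weight as a
   sum of increments v_k - v_(k-1) bounds the optimum by a combination of the
   maximum cardinality matchings of the subgraphs {w >= v_k}, whose densities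
   are q_k / (1 + q_k) with q_k = Pr(w >= v_k); this is the denominator.
   The second inequality is checked one increment at a time: with
   r = (K - 1) / (K + 1), it says that (1 - r^l) (K + l) / l is nonincreasing. *)
Require Import Defs.
From HB Require Import structures.
From mathcomp Require Import all_boot all_order all_algebra.
From mathcomp Require Import all_classical all_reals all_analysis.
From mathcomp Require Import ring lra zify.

Import Order.TTheory GRing.Theory Num.Theory.
Import numFieldNormedType.Exports.

Set Implicit Arguments.
Unset Strict Implicit.
Unset Printing Implicit Defensive.

Local Open Scope ring_scope.

(** * Optimal matchings of a path *)

Section PathOptimum.
Variable R : realDomainType.
Implicit Types (s t : seq R) (b : nat -> bool).

(* [gain (w :: t)] is the increase of the optimal matching weight caused by
   prepending an edge of weight [w] to a path with edge weights [t]. *)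
Fixpoint gain s : R := if s is w :: t then Num.max 0 (w - gain t) else 0.

Fixpoint opt s : R := if s is _ :: t then gain s + opt t else 0.

Definition nonadjacent b := forall i, ~~ (b i && b i.+1).

(** Since [opt t - gain t = opt (behead t)], the accumulated gains obey the usual dynamic program:
    skip the first edge, or take it and lose its neighbor. *)
Lemma opt_cons w t : opt (w :: t) = Num.max (opt t) (w + opt (behead t)).
Proof.
rewrite /= addr_maxl add0r; congr Num.max.
by case: t => [|w' t] /=; ring.
Qed.

Lemma gain_ge0 s : 0 <= gain s.
Proof. by case: s => //= w t; rewrite le_max lexx. Qed.

Lemma opt_ge0 s : 0 <= opt s.
Proof. by elim: s => //= w t IH; rewrite addr_ge0 // (gain_ge0 (w :: t)). Qed.

Lemma opt_ub b s : nonadjacent b ->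
  \sum_(i < size s) (b i)%:R * s`_i <= opt s.
Proof.
have [m] := ubnP (size s); elim: m => // m IH in b s *.
case: s => [|w t] /= ltm bP; first by rewrite big_ord0.
rewrite -/(opt (w :: t)) opt_cons le_max big_ord_recl /=.
have shift k : nonadjacent (fun i => b (k + i)%N).
  by move=> i; rewrite addnS bP.
have [b0|b0] := boolP (b 0%N); last first.
  by rewrite mul0r add0r (IH (fun i => b i.+1)) ?orbT // (shift 1%N).
apply/orP; right; rewrite mul1r lerD2l.
case: t ltm => [|w' t] /= ltm; first by rewrite big_ord0.
have := bP 0%N; rewrite b0 /= => /negbTE b1.
rewrite big_ord_recl /= b1 mul0r add0r.
by apply: (IH (fun i => b i.+2)); [lia | exact: (shift 2%N)].
Qed.

Lemma opt_attained s : exists2 b, nonadjacent b &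
  \sum_(i < size s) (b i)%:R * s`_i = opt s.
Proof.
have [m] := ubnP (size s); elim: m => // m IH in s *.
case: s => [|w t] ltm.
  by exists (fun=> false) => [?|] //=; rewrite big_ord0.
rewrite opt_cons; case: lerP => _.
  case: (IH (behead t)) => [|b bP <-]; first by case: t ltm => //= *; lia.
  exists (fun i => if i is j.+1 then if j is k.+1 then b k else false else true).
    by case=> [|[|i]] /=.
  rewrite /= big_ord_recl /= mul1r; congr (_ + _).
  case: t {ltm} => [|w' t] /=; rewrite ?big_ord0 // big_ord_recl mul0r add0r.
  exact: eq_bigr.
case: (IH t) => [|b bP <-]; first exact: ltm.
exists (fun i => if i is j.+1 then b j else false); first by case=> [|i] //=.
by rewrite /= big_ord_recl mul0r add0r; apply: eq_bigr.
Qed.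

(** An optimal matching of the concatenation restricts to matchings of both parts. This
    subadditivity feeds Fekete's lemma. *)
Lemma opt_cat s t : opt (s ++ t) <= opt s + opt t.
Proof.
have [b bP <-] := opt_attained (s ++ t).
rewrite size_cat big_split_ord /=; apply: lerD.
  apply: le_trans (opt_ub s bP); rewrite le_eqVlt; apply/orP; left.
  by apply/eqP/eq_bigr => i _; rewrite nth_cat ltn_ord.
have bP' : nonadjacent (fun i => b (size s + i)%N) by move=> i; rewrite addnS bP.
apply: le_trans (opt_ub t bP'); rewrite le_eqVlt; apply/orP; left.
by apply/eqP/eq_bigr => i _; rewrite nth_cat ltnNge leq_addr addKn.
Qed.

(** [opt] is a maximum of linear functionals, hence sublinear: the pattern optimal for [f] is
    admissible for every [g i]. *)
Lemma opt_sum (T : eqType) (I : finType) (c : I -> R) (g : I -> T -> R)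
    (f : T -> R) (s : seq T) :
  (forall i, 0 <= c i) -> {in s, forall x, f x = \sum_i c i * g i x} ->
  opt [seq f x | x <- s] <= \sum_i c i * opt [seq g i x | x <- s].
Proof.
move=> c0 fE; have [b bP <-] := opt_attained [seq f x | x <- s].
case: s => [|x0 s'] in fE *.
  by rewrite big_ord0 sumr_ge0 // => i _; rewrite mulr0.
set s := x0 :: s' in fE *.
rewrite (eq_bigr (fun j : 'I_(size [seq f x | x <- s]) =>
  \sum_i c i * ((b j)%:R * g i (nth x0 s j)))); last first.
  move=> j _; have js : (j < size s)%N by rewrite -(size_map f).
  rewrite (nth_map x0) // fE ?mem_nth // mulr_sumr.
  by apply: eq_bigr => i _; ring.
rewrite exchange_big; apply: ler_sum => i _; rewrite -mulr_sumr.
apply: ler_wpM2l => //; apply: le_trans (opt_ub [seq g i x | x <- s] bP).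
rewrite !size_map le_eqVlt; apply/orP; left; apply/eqP/eq_bigr => j _.
by rewrite (nth_map x0).
Qed.

End PathOptimum.

(** * Matchings of the path graph as nonadjacent edge patterns *)

Section PathMatchings.
Variable R : realDomainType.
Implicit Types (W : seq R) (b : nat -> bool).

(** The condition on [e.2] forces [e.1 < m], so only the values of [b] below [m] are read. *)
Definition path_edges m b : {set 'I_m.+1 * 'I_m.+1} :=
  [set e : 'I_m.+1 * 'I_m.+1 | (e.2 == e.1.+1 :> nat) && b e.1].

Lemma matching_weight_path_edges m W b :
  matching_weight (path_wt W) (path_edges m b) =
  \sum_(i < m) (b i)%:R * W`_i.
Proof.
pose h (i : 'I_m) : 'I_m.+1 * 'I_m.+1 := (widen_ord (leqnSn m) i, lift ord0 i).
have hI : injective h by move=> i j [] ij; apply: val_inj.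
have -> : path_edges m b = h @: [set i : 'I_m | b i].
  apply/setP => -[u w]; rewrite !inE /=; apply/andP/imsetP => [[/eqP uw bu]|].
    have um : (u < m)%N by have := ltn_ord w; rewrite uw.
    by exists (Ordinal um); rewrite ?inE //; congr (_, _); apply: val_inj.
  by case=> i; rewrite inE => bi [-> ->] /=; rewrite eqxx.
rewrite /matching_weight big_imset /=; last by move=> i j _ _ /hI.
rewrite big_mkcond /=; apply: eq_bigr => i _; rewrite inE /path_wt.
have -> : minn (h i).1 (h i).2 = i by rewrite /= /bump /=; lia.
by case: (b i); rewrite ?mul1r ?mul0r.
Qed.

Lemma is_matching_path_edges m b :
  nonadjacent b -> is_matching (@path_adj m.+1) (path_edges m b).
Proof.
move=> bP; apply/andP; split.
  apply/forall_inP => e; rewrite inE => /andP[/eqP e12 _].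
  by rewrite /path_adj e12 ltnSn eqxx.
apply/forall_inP => -[e1 e2]; rewrite inE /= => /andP[/eqP e12 be].
apply/forall_inP => -[f1 f2]; rewrite inE /= => /andP[/eqP f12 bf].
apply/implyP => nef; rewrite disjoint_subset; apply/fintype.subsetP => x.
have ne1 : e1 != f1 :> nat.
  apply: contraNneq nef => ef; apply/eqP; congr (_, _); apply: val_inj => //=.
  by rewrite e12 f12 ef.
have ne2 : (e1.+1 == f1 :> nat) = false.
  by apply: contraTF be => /eqP ef; have := bP e1; rewrite ef bf andbT.
have ne3 : (f1.+1 == e1 :> nat) = false.
  by apply: contraTF bf => /eqP ef; have := bP f1; rewrite ef be andbT.
rewrite !inE => /orP[]/eqP ->; rewrite -!(inj_eq val_inj) /= ?e12 ?f12; lia.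
Qed.

Lemma path_matching_edges m (M : {set 'I_m.+1 * 'I_m.+1}) :
  is_matching (@path_adj m.+1) M ->
  exists2 b, nonadjacent b & M = path_edges m b.
Proof.
move=> /andP[/forall_inP Madj /forall_inP Mdis].
(* The guard keeps [inord] in range; beyond it [inord] would return 0. *)
pose b i := (i < m)%N && ((inord i, inord i.+1) \in M).
exists b => [i|].
  apply/negP => /andP[/andP[im iM] /andP[i1m i1M]].
  have := forall_inP (Mdis _ iM) _ i1M.
  have -> : ((inord i, inord i.+1) != (inord i.+1, inord i.+2) :> 'I_m.+1 * 'I_m.+1).
    by apply/eqP => -[/(congr1 val)]; rewrite /= !inordK; lia.
  rewrite disjoint_subset => /fintype.subsetP/(_ (inord i.+1)).
  by rewrite !inE eqxx orbT => /(_ isT).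
apply/setP => -[u w]; rewrite !inE /=.
apply/idP/andP => [uwM|[/eqP uw /andP[_]]]; last by rewrite -uw !inord_val.
have /= := Madj _ uwM; rewrite /path_adj => uw.
have wE : w = u.+1 :> nat by lia.
rewrite wE eqxx /b -wE !inord_val uwM andbT; split=> //.
by have := ltn_ord w; rewrite wE.
Qed.

Lemma fstar_path m W : size W = m -> fstar (@path_adj m.+1) (path_wt W) = opt W.
Proof.
move=> sW; apply/eqP; rewrite eq_le; apply/andP; split.
  apply: bigmax_le; first exact: opt_ge0.
  move=> M /path_matching_edges[b bP ->].
  by rewrite matching_weight_path_edges -sW opt_ub.
have [b bP <-] := opt_attained W; rewrite sW -matching_weight_path_edges.
exact: le_bigmax_cond (is_matching_path_edges m bP).
Qed.

End PathMatchings.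

(** * The greedy matching of a path *)

Section GreedyOnPath.
Variable R : realDomainType.
Variables (m : nat) (W : seq R) (a b : nat -> bool).
Hypothesis sizeW : size W = m.
Hypothesis W_ge0 : forall i, 0 <= W`_i.
Hypothesis a0 : a 0%N = false.
(** [a i] and [b i] say that edge [i] is blocked from the left and from the right. Ties go to the
    left edge, so the first comparison is weak and the second strict. *)
Hypothesis aS : forall i, a i.+1 = (W`_i.+1 <= W`_i) && ~~ a i.
Hypothesis bE : forall i, b i = (W`_i < W`_i.+1) && ~~ b i.+1.

Local Notation sel := (fun i : nat => ~~ a i && ~~ b i).

(** Of two adjacent edges one outranks the other, and the recursion in that direction makes exactly
    one of the two blocked from that side. *)
Lemma selected_nonadjacent : nonadjacent sel.
Proof.
move=> i; rewrite aS bE; case: (a i) => //=; rewrite andbT -ltNge.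
by case: ltP => //= _; case: (b i.+1).
Qed.

(* If u and w propose to each other although the other edge at u outranks
   {u, w}, then the other neighbor of u is already matched, through a selected
   edge; that edge blocks the outranking one. *)
Lemma greedy_step_selected (M : {set 'I_m.+1 * 'I_m.+1}) :
  M \subset path_edges m sel ->
  greedy_step (@path_adj m.+1) (path_wt W) M \subset path_edges m sel.
Proof.
move=> /fintype.subsetP Msel; apply/fintype.subsetP => e.
rewrite finset.in_setU => /orP[/Msel //|]; rewrite inE.
case: e => u w /= /and3P[uw /and4P[uU wU adjuw /forall_inP upr]].
move=> /and4P[_ _ _ /forall_inP wpr].
have wE : w = u.+1 :> nat by move: adjuw; rewrite /path_adj; lia.
rewrite inE /= wE eqxx /=.
have wtE (x y : 'I_m.+1) : y = x.+1 :> nat ->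
    path_wt W x y = W`_x /\ path_wt W y x = W`_x.
  by move=> yx; rewrite /path_wt; split; congr (_`_ _); lia.
have matched (x : 'I_m.+1) : x \notin unmatched M ->
    exists2 e, e \in M & (x == e.1) || (x == e.2).
  rewrite inE => /forall_inPn[e eM]; rewrite negb_and !negbK => xe.
  by exists e.
have free (x : 'I_m.+1) e : x \in unmatched M -> e \in M ->
    (x != e.1 :> nat) /\ (x != e.2 :> nat).
  by rewrite inE => /forall_inP xU /xU/andP[].
apply/andP; split.
  have [/eqP u0|u0] := boolP (u == 0 :> nat)%N; first by rewrite u0 a0.
  have lu : (u.-1 < m.+1)%N by have := ltn_ord u; lia.
  pose x := Ordinal lu; have ux : u = x.+1 :> nat by rewrite /=; lia.
  rewrite ux aS -ux; apply/negP => /andP[wux nax].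
  have [xU|/matched[e eM xe]] := boolP (x \in unmatched M).
    have := upr x xU; rewrite {1}/path_adj -ux eqxx orbT implyTb.
    have [_ ->] := wtE _ _ ux; have [-> _] := wtE _ _ wE.
    by rewrite ltNge wux /= => /andP[_]; lia.
  have := Msel _ eM; rewrite inE /= => /andP[/eqP e12 /andP[nae nbe]].
  have [ne1 ne2] := free _ _ uU eM.
  have e2x : e.2 = x :> nat.
    move: xe => /orP[]/eqP xe; last by rewrite xe.
    by move: ne2; rewrite e12 -xe ux eqxx.
  rewrite e2x in e12; move: nax nbe; rewrite e12 aS bE -e12 nae andbT -ltNge.
  by move=> ->; rewrite bE -ux ltNge wux.
rewrite bE -wE; apply/negP => /andP[wuw nbw].
(* Past the last edge the default weight 0 cannot exceed a nonnegative weight, so an edge blocked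
   from the right has a right neighbor. *)
have wm : (w < m)%N.
  rewrite ltnNge; apply/negP => mw; move: wuw.
  by rewrite [W`_w]nth_default ?sizeW // ltNge W_ge0.
pose x := Ordinal (wm : (w.+1 < m.+1)%N); have xw : x = w.+1 :> nat by [].
have [xU|/matched[e eM xe]] := boolP (x \in unmatched M).
  have := wpr x xU; rewrite {1}/path_adj xw eqxx implyTb.
  have [-> _] := wtE _ _ xw; have [_ ->] := wtE _ _ wE.
  by rewrite ltNge (ltW wuw) /= (gt_eqF wuw).
have := Msel _ eM; rewrite inE /= => /andP[/eqP e12 /andP[nae nbe]].
have [ne1 ne2] := free _ _ wU eM.
have e1x : e.1 = x :> nat.
  move: xe => /orP[]/eqP xe; first by rewrite xe.
  by move: ne1; rewrite -eqSS -e12 -xe xw eqxx.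
rewrite wE in xw wuw; move: nae nbe nbw.
rewrite e1x xw wE !aS [W`_u.+1 <= _]leNgt wuw /= andbT.
by rewrite -ltNge [b u.+1]bE => -> ->.
Qed.

(** Only selected edges are ever added. Conversely, greedy stops at a maximal matching, so a
    selected edge has an endpoint covered by a greedy edge; that edge is selected too, and distinct
    selected edges are disjoint, so the two coincide. *)
Lemma greedy_path : greedy (@path_adj m.+1) (path_wt W) = path_edges m sel.
Proof.
set G := greedy _ _.
have /fintype.subsetP Gsel : G \subset path_edges m sel.
  rewrite /G /greedy; set step := greedy_step _ _.
  suff H k : iter k step finset.set0 \subset path_edges m sel by exact: H.
  elim: k => [|k IH] /=; first exact: finset.sub0set.
  exact: greedy_step_selected.
have adjI : irreflexive (@path_adj m.+1) by move=> u; rewrite /path_adj; lia.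
have adjC : symmetric (@path_adj m.+1) by move=> u w; rewrite /path_adj orbC.
have wtC (u w : 'I_m.+1) : path_wt W u w = path_wt W w u.
  by rewrite /path_wt minnC.
have stop := greedy_stops adjI adjC wtC.
apply/setP => -[u w]; apply/idP/idP => [/Gsel //|uwS].
have := is_matching_path_edges m selected_nonadjacent.
move=> /andP[_ /forall_inP Mdis].
have matched (x : 'I_m.+1) : x \in [set u; w] ->
    x \notin unmatched G -> (u, w) \in G.
  move=> xuw; rewrite inE => /forall_inPn[e eG]; rewrite negb_and !negbK => xe.
  have [<- //|ne] := eqVneq e (u, w).
  have := implyP (forall_inP (Mdis _ (Gsel _ eG)) _ uwS) ne.
  rewrite disjoint_subset => /fintype.subsetP/(_ x).
  by rewrite !inE xe -finset.in_set2 xuw => /(_ isT).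
have [uU|/matched] := boolP (u \in unmatched G); last by apply; rewrite !inE eqxx.
have [wU|/matched] := boolP (w \in unmatched G); last by apply; rewrite !inE eqxx orbT.
have := stop _ _ uU wU; move: uwS; rewrite inE /= => /andP[/eqP wE _].
by rewrite /path_adj wE eqxx.
Qed.

Lemma fhat_path :
  fhat (@path_adj m.+1) (path_wt W) = \sum_(i < m) (sel i)%:R * W`_i.
Proof. by rewrite /fhat greedy_path matching_weight_path_edges. Qed.

End GreedyOnPath.

(** * Expectations over i.i.d. weights *)

Section IidExpectation.
Variables (R : realFieldType) (K : nat) (v p : nat -> R).
Implicit Types (f g : seq R -> R) (m : nat).
Local Notation E := (iid_expectation K v p).

Lemma iid_expectation0 f : E 0 f = f [::].
Proof.
rewrite /iid_expectation (big_pred1 [tuple]); last first.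
  by move=> t; apply/esym/eqP/val_inj/size0nil/size_tuple.
by rewrite big_nil mul1r.
Qed.

Lemma iid_expectationS m f :
  E m.+1 f = \sum_(j < K) p j.+1 * E m (fun s => f (v j.+1 :: s)).
Proof.
under eq_bigr => j _ do rewrite mulr_sumr.
rewrite pair_big /= /iid_expectation.
rewrite (reindex (fun q : 'I_K * m.-tuple 'I_K => [tuple of q.1 :: q.2])) /=.
  by apply: eq_bigr => -[j t] _ /=; rewrite big_cons mulrA.
exists (fun t : m.+1.-tuple 'I_K => (thead t, [tuple of behead t])).
  by move=> [j t] _; congr (_, _); apply: val_inj.
by move=> t _; rewrite /= [t in RHS]tuple_eta; apply: val_inj.
Qed.

Lemma eq_iid_expectation m f g :
  (forall t : seq 'I_K, size t = m ->
    f [seq v (val j).+1 | j <- t] = g [seq v (val j).+1 | j <- t]) ->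
  E m f = E m g.
Proof.
move=> fg; apply: eq_bigr => t _; congr (_ * _); exact/fg/size_tuple.
Qed.

Lemma iid_expectationD m f g : E m (fun s => f s + g s) = E m f + E m g.
Proof. by rewrite -big_split; apply: eq_bigr => t _; rewrite mulrDr. Qed.

Lemma iid_expectationZ m c f : E m (fun s => c * f s) = c * E m f.
Proof. by rewrite mulr_sumr; apply: eq_bigr => t _; rewrite mulrCA. Qed.

Lemma iid_expectation_sum (I : finType) m (f : I -> seq R -> R) :
  E m (fun s => \sum_i f i s) = \sum_i E m (f i).
Proof.
rewrite exchange_big /=; apply: eq_bigr => t _; exact: mulr_sumr.
Qed.

Lemma iid_expectation_cat m1 m2 f :
  E (m1 + m2) f = E m1 (fun s => E m2 (fun t => f (s ++ t))).
Proof.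
elim: m1 f => [|m1 IH] f; first by rewrite iid_expectation0.
rewrite addSn !iid_expectationS; apply: eq_bigr => j _; congr (_ * _).
exact: IH.
Qed.

Hypothesis p_ge0 : forall j, (j < K)%N -> 0 <= p j.+1.

Lemma le_iid_expectation m f g :
  (forall t : seq 'I_K, size t = m ->
    f [seq v (val j).+1 | j <- t] <= g [seq v (val j).+1 | j <- t]) ->
  E m f <= E m g.
Proof.
move=> fg; apply: ler_sum => t _; apply: ler_wpM2l.
  by rewrite prodr_ge0 // => j _; rewrite p_ge0.
exact/fg/size_tuple.
Qed.

Hypothesis p_sum : \sum_(j < K) p j.+1 = 1.

Lemma iid_expectation_cst m c : E m (fun=> c) = c.
Proof.
elim: m => [|m IH]; first by rewrite iid_expectation0.
by rewrite iid_expectationS IH -mulr_suml p_sum mul1r.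
Qed.

End IidExpectation.

(** * Blocking recursions on weight sequences *)

Section Blocking.
Variable R : realDomainType.
Implicit Types (s t W : seq R) (c : bool).

(* [blockedl c W i] (resp. [blockedr (drop i W)]): edge [i] is adjacent to a
   higher-ranked selected edge on its left (resp. right), where [c] states that
   edge [0] is blocked from the left.  For nonnegative weights, the default [0]
   of [head] never blocks the last edge. *)
Fixpoint blockedl c W i :=
  if i is j.+1 then (W`_i <= W`_j) && ~~ blockedl c W j else c.

Fixpoint blockedr s :=
  if s is w :: t then (w < head 0 t) && ~~ blockedr t else false.

(** A scan from the left, with [c] the left status of the current edge; this Markov form allows
    conditioning on one weight at a time. *)
Fixpoint greedy_weight c s : R :=
  if s is w :: t then (~~ c && ~~ blockedr s)%:R * w +
    greedy_weight ((head 0 t <= w) && ~~ c) t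
  else 0.

Lemma blockedr_drop W i :
  blockedr (drop i W) = (W`_i < W`_i.+1) && ~~ blockedr (drop i.+1 W).
Proof.
have [iW|Wi] := ltnP i (size W); last first.
  by rewrite !drop_oversize ?nth_default ?ltxx // ltnW.
by rewrite (drop_nth 0 iW) /= -nth0 nth_drop addn0.
Qed.

Lemma greedy_weightE c W : greedy_weight c W =
  \sum_(i < size W) (~~ blockedl c W i && ~~ blockedr (drop i W))%:R * W`_i.
Proof.
elim: W c => [|w t IH] c; first by rewrite big_ord0.
rewrite [LHS]/= big_ord_recl IH; congr (_ + _).
apply: eq_bigr => i _; rewrite lift0; congr ((~~ _ && _)%:R * _).
elim: (val i) => [|j IHj] /=; first by rewrite nth0.
by rewrite IHj.
Qed.

Lemma fhat_greedy_weight m W : size W = m -> (forall i, 0 <= W`_i) ->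
  fhat (@path_adj m.+1) (path_wt W) = greedy_weight false W.
Proof.
move=> sW W0; rewrite greedy_weightE sW.
apply: (@fhat_path _ _ _ (blockedl false W) (fun i => blockedr (drop i W))) => //.
exact: blockedr_drop.
Qed.

Lemma greedy_weight_le_opt W : (forall i, 0 <= W`_i) -> greedy_weight false W <= opt W.
Proof.
move=> W0; rewrite greedy_weightE.
apply: (opt_ub (b := fun i => ~~ blockedl false W i && ~~ blockedr (drop i W))).
by apply: selected_nonadjacent => // i; exact: blockedr_drop.
Qed.

End Blocking.

(** * Expected greedy weight as a sum over positions *)

Section GreedyExpectation.
Variables (R : realFieldType) (K : nat) (v : nat -> R).
Hypothesis K_gt0 : (0 < K)%N.
Hypothesis v1_ge0 : 0 <= v 1%N.
Hypothesis v_incr : forall k, (1 <= k < K)%N -> v k < v k.+1.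

Local Notation p := (K%:R^-1 : R).
Local Notation E := (iid_expectation K v (fun=> p)).

Lemma value_lt (i j : 'I_K) : (v i.+1 < v j.+1) = (i < j)%N.
Proof.
have lt (x y : 'I_K) : (x < y)%N -> v x.+1 < v y.+1.
  case: x y => x xK [y yK] /=; elim: y yK => // y IH yK.
  rewrite ltnS leq_eqVlt => /orP[/eqP ->|xy]; first exact: v_incr.
  by apply: lt_trans (IH (ltnW yK) xy) _; exact: v_incr.
have [|ji|/val_inj ->] := ltngtP i j; [exact: lt| |exact: ltxx].
by apply/negbTE; rewrite -leNgt ltW // lt.
Qed.

Lemma value_le (i j : 'I_K) : (v i.+1 <= v j.+1) = (i <= j)%N.
Proof. by rewrite leNgt value_lt -leqNgt. Qed.

Lemma value_ge0 (i : 'I_K) : 0 <= v i.+1.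
Proof.
by apply: le_trans v1_ge0 _; rewrite (value_le (Ordinal K_gt0) i).
Qed.

Lemma values_ge0 (t : seq 'I_K) i : 0 <= [seq v (val j).+1 | j <- t]`_i.
Proof.
elim: t i => [|j t IH] [|i] //=; exact: value_ge0.
Qed.

Lemma uniform_ge0 : 0 <= p. Proof. by rewrite invr_ge0 ler0n. Qed.

Lemma natr_mul_uniform : K%:R * p = 1. Proof. by rewrite divff // pnatr_eq0 -lt0n. Qed.

Lemma sum_uniform : \sum_(j < K) p = 1.
Proof. by rewrite sumr_const card_ord -[LHS]mulr_natl natr_mul_uniform. Qed.

(* The probabilities that an edge of weight [v k.+1] is not blocked by the [m]
   edges on its right, resp. by the [m] edges on its left. *)
Definition right_free m (k : 'I_K) : R :=
  E m (fun t => (~~ blockedr (v k.+1 :: t))%:R).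

Fixpoint left_free m (k : 'I_K) : R :=
  if m is m'.+1 then 1 - p * \sum_(j < K | (k <= j)%N) left_free m' j else 1.

Lemma right_free0 k : right_free 0 k = 1.
Proof. by rewrite /right_free iid_expectation0 /= ltNge value_ge0. Qed.

(** Condition on the next edge: it blocks iff it is strictly heavier and itself free from the right.
    In [left_free] the comparison is weak because ties favor the left edge. *)
Lemma right_freeS m k :
  right_free m.+1 k = 1 - p * \sum_(j < K | (k < j)%N) right_free m j.
Proof.
rewrite /right_free iid_expectationS -[X in _ = X - _]sum_uniform.
rewrite mulr_sumr [X in _ - X]big_mkcond -sumrB.
apply: eq_bigr => j _ /=; rewrite value_lt; case: ltnP => _ /=; last first.
  by rewrite (iid_expectation_cst v (p := fun=> p) sum_uniform) mulr1 subr0.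
rewrite -[X in X - _]mulr1 -mulrBr; congr (_ * _).
rewrite -[X in X - _](iid_expectation_cst v (p := fun=> p) sum_uniform m) -[in RHS]mulN1r.
rewrite -iid_expectationZ -iid_expectationD; apply: eq_iid_expectation => t _.
by case: (v _ < _); case: (blockedr _) => /=; ring.
Qed.

(* Expected greedy weight of [m.+1] edges when the first one, given that it has
   weight [v k.+1], is free from the left with probability [x k]. *)
Definition mixed_weight m (x : 'I_K -> R) : R := p * \sum_(k < K)
  (x k * E m (fun t => greedy_weight false (v k.+1 :: t)) +
   (1 - x k) * E m (fun t => greedy_weight true (v k.+1 :: t))).

Lemma mixed_weight0 x :
  mixed_weight 0 x = p * \sum_(k < K) x k * v k.+1 * right_free 0 k.
Proof.
congr (_ * _); apply: eq_bigr => k _.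
by rewrite !iid_expectation0 right_free0 /= ltNge value_ge0 /=; ring.
Qed.

(** The first edge counts if it is free on both sides, which are independent events given its
    weight. The new function is the probability that the second edge, given its weight, is free from
    the left. *)
Lemma mixed_weightS m x : mixed_weight m.+1 x =
  p * \sum_(k < K) x k * v k.+1 * right_free m.+1 k +
  mixed_weight m (fun j => 1 - p * \sum_(k < K | (j <= k)%N) x k).
Proof.
pose u c k := E m (fun t => greedy_weight c (v k.+1 :: t)).
have uS c (k : 'I_K) : E m.+1 (fun t => greedy_weight c (v k.+1 :: t)) =
    (~~ c)%:R * v k.+1 * right_free m.+1 k +
    p * \sum_(j < K) u ((j <= k)%N && ~~ c) j.
  rewrite /right_free -iid_expectationZ [in X in _ + X]mulr_sumr.
  rewrite (_ : \sum_(j < K) p * u _ _ = E m.+1 (fun t =>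
      greedy_weight ((head 0 t <= v k.+1) && ~~ c) t)); last first.
    by rewrite iid_expectationS; apply: eq_bigr => j _ /=; rewrite value_le.
  rewrite -iid_expectationD; apply: eq_iid_expectation => t _ /=.
  by case: c => /=; [rewrite !mul0r | rewrite mul1r mulrC].
rewrite /mixed_weight -mulrDr; congr (_ * _).
under eq_bigr => k _ do rewrite !uS /= mul0r mul0r add0r mul1r mulrDr mulrA -addrA.
rewrite big_split /=; congr (_ + _).
transitivity (\sum_(k < K) \sum_(j < K) p *
   (x k * u (j <= k)%N j + (1 - x k) * u false j)).
  apply: eq_bigr => k _; rewrite mulrCA [X in _ + X]mulrCA -mulrDr -mulr_sumr.
  congr (_ * _); rewrite !mulr_sumr -big_split; apply: eq_bigr => j _ /=.
  by rewrite andbT andbF.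
rewrite exchange_big; apply: eq_bigr => j _; rewrite -/(u false j) -/(u true j).
(* [S] is the probability that a second edge of weight [v j.+1] is blocked from the left. *)
set S := p * _; have SE : S = \sum_(k < K) p * (if (j <= k)%N then x k else 0).
  by rewrite /S big_mkcond mulr_sumr.
rewrite subKr; have -> : 1 - S = \sum_(k < K) (p - p * (if (j <= k)%N then x k else 0)).
  by rewrite sumrB sum_uniform SE.
rewrite SE !mulr_suml -big_split; apply: eq_bigr => k _ /=.
by case: leqP => _; ring.
Qed.

(** The update of [x] in [mixed_weightS] is the recursion of [left_free], so [t] steps reach
    [left_free (s + t)], with [m - t] edges remaining on the right. *)
Lemma mixed_weight_left_free m s : mixed_weight m (left_free s) =
  p * \sum_(k < K) v k.+1 * \sum_(t < m.+1) left_free (s + t) k * right_free (m - t) k.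
Proof.
elim: m s => [|m IH] s.
  rewrite mixed_weight0; congr (_ * _); apply: eq_bigr => k _.
  by rewrite big_ord1 addn0; ring.
rewrite mixed_weightS -/(left_free s.+1) IH -mulrDr -big_split; congr (_ * _).
apply: eq_bigr => k _ /=; rewrite [in RHS]big_ord_recl addn0 subn0 mulrDr.
congr (_ + _); first by ring.
by congr (_ * _); apply: eq_bigr => t _; rewrite lift0 subSS addnS.
Qed.

Lemma iid_expectation_greedy_weight m : E m.+1 (greedy_weight false) =
  p * \sum_(k < K) v k.+1 * \sum_(t < m.+1) left_free t k * right_free (m - t) k.
Proof.
rewrite -(mixed_weight_left_free m 0) /mixed_weight iid_expectationS mulr_sumr.
by apply: eq_bigr => k _ /=; rewrite subrr mul0r addr0 mul1r.
Qed.

End GreedyExpectation.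

(** * Limit of the expected greedy weight *)

Lemma sum_geometric_tail (R : pzRingType) (K : nat) (x : R) k : (k <= K)%N ->
  (1 - x) * (\sum_(j < K | (k <= j)%N) x ^+ (K - j.+1)) = 1 - x ^+ (K - k).
Proof.
move=> kK; rewrite -(big_geq_mkord k K xpredT (fun j => x ^+ (K - j.+1))).
rewrite -{1}(subKn kK); elim: (K - k)%N (leq_subr k K) => [|n IH] nK.
  by rewrite subn0 big_geq // expr0 subrr mulr0.
rewrite big_ltn ?mulrDr; last by lia.
rewrite (_ : (K - n.+1).+1 = K - n)%N ?IH; [|lia|lia].
by rewrite subKn 1?ltnW // mulrBl mul1r -exprS addrC addrA subrK.
Qed.

Section BlockingLimits.
Variables (R : realFieldType) (K : nat).
Hypothesis K_gt0 : (0 < K)%N.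

Local Notation p := (K%:R^-1 : R).
Local Notation uniform_ge0 := (uniform_ge0 R K).
Local Notation natr_mul_uniform := (natr_mul_uniform R K_gt0).

(** The fixed points of the recursions of [left_free] and [right_free], solved downward from the
    largest weight. *)
Definition left_limit (k : nat) : R := (K%:R / K.+1%:R) ^+ (K - k).
Definition right_limit (k : nat) : R := (1 - p) ^+ (K - k.+1).

Lemma left_limitE k : (k <= K)%N ->
  left_limit k = 1 - p * \sum_(j < K | (k <= j)%N) left_limit j.
Proof.
move=> kK; pose x : R := K%:R / K.+1%:R.
have K0 : K%:R != 0 :> R by rewrite pnatr_eq0 -lt0n.
have K1 : K.+1%:R != 0 :> R by rewrite pnatr_eq0.
have px : p * x = 1 - x by rewrite /x -natr1 in K1 *; field; rewrite K0 K1.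
rewrite /left_limit -/x -{1}[x ^+ _](subKr 1).
rewrite -sum_geometric_tail // -px -mulrA mulr_sumr.
by congr (_ - _ * _); apply: eq_bigr => j _; rewrite -exprS -subSn.
Qed.

Lemma right_limitE k : (k < K)%N ->
  right_limit k = 1 - p * \sum_(j < K | (k < j)%N) right_limit j.
Proof.
by move=> kK; rewrite -{1}[p](subKr 1) sum_geometric_tail // subKr.
Qed.

Lemma left_free_itv m (k : 'I_K) : 0 <= left_free R m k <= 1.
Proof.
elim: m k => [|m IH] k /=; first by rewrite lexx ler01.
have S0 : 0 <= p * \sum_(j < K | (k <= j)%N) left_free R m j.
  by rewrite mulr_ge0 ?uniform_ge0 ?sumr_ge0 // => j _; case/andP: (IH j).
have S1 : p * \sum_(j < K | (k <= j)%N) left_free R m j <= 1.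
  rewrite -[leRHS]natr_mul_uniform mulrC ler_wpM2r ?uniform_ge0 // -[leRHS]mulr1.
  rewrite -[K in leRHS]card_ord -sum1_card natr_sum mulr_suml [leLHS]big_mkcond.
  apply: ler_sum => j _; rewrite mul1r.
  by case: ifP => // _; case/andP: (IH j).
by rewrite subr_ge0 S1 lerBlDr lerDl S0.
Qed.

Lemma right_limit_itv k : 0 <= right_limit k <= 1.
Proof.
have x0 : 0 <= 1 - p by rewrite subr_ge0 invf_le1 ?ler1n ?ltr0n.
by rewrite exprn_ge0 //= exprn_ile1 // lerBlDr lerDl uniform_ge0.
Qed.

(* Only the Cesaro means of [left_free] converge in general: for [K = 1] the
   sequence alternates between 1 and 0. *)
Lemma left_free_cesaro m (k : 'I_K) :
  `|\sum_(t < m) left_free R t k - m%:R * left_limit k| <= (K - k)%:R.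
Proof.
pose e (j : 'I_K) := \sum_(t < m) left_free R t j - m%:R * left_limit j.
rewrite -/(e k); have [n] := ubnP (K - k)%N; elim: n k => // n IH k kn.
(* Split off the last term, then the first term, of the sum over [m.+1] terms; the recursion unfolds
   the shifted sum. *)
have sumE : \sum_(t < m) left_free R t k + left_free R m k =
    1 + (m%:R - p * \sum_(j < K | (k <= j)%N) \sum_(t < m) left_free R t j).
  have := erefl (\sum_(t < m.+1) left_free R t k).
  rewrite {1}big_ord_recr big_ord_recl /= => ->; congr (_ + _).
  by rewrite exchange_big sumrB sumr_const card_ord mulr_sumr.
have eE : (1 + p) * e k = 1 - left_free R m k - p * \sum_(j < K | (k < j)%N) e j.
  have Dk (F : 'I_K -> R) : \sum_(j < K | (k <= j)%N) F j =
      F k + \sum_(j < K | (k < j)%N) F j.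
    rewrite (bigD1 k) //=; congr (_ + _); apply: eq_bigl => j.
    by rewrite ltn_neqAle eq_sym andbC.
  rewrite /e sumrB -mulr_sumr; have := left_limitE (ltnW (ltn_ord k)).
  move: sumE; rewrite !Dk.
  set A := \sum_(t < m) _; set B := \sum_(j < K | _) \sum_(t < m) _.
  set L := \sum_(j < K | _) _; move=> h1 h2.
  rewrite mulrBr [X in _ - X]mulrCA.
  have -> : (1 + p) * left_limit k = 1 - p * L by rewrite mulrDl {1}h2; ring.
  have -> : left_free R m k = 1 + (m%:R - p * (A + B)) - A by rewrite -h1; ring.
  by ring.
have ek : `|e k| <= (1 + p) * `|e k|.
  by rewrite mulrDl mul1r lerDl mulr_ge0 ?uniform_ge0.
apply: (le_trans ek); rewrite -[1 + p]ger0_norm ?addr_ge0 ?uniform_ge0 // -normrM eE.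
apply: le_trans (ler_normB _ _) _.
(* One unit pays for the boundary term [1 - left_free]; the rest pays for the errors of heavier
   weights, each at most [K - k.+1] by induction. *)
have -> : (K - k)%:R = 1 + p * (K%:R * (K - k.+1)%:R) :> R.
  by rewrite mulrA [p * _]mulrC natr_mul_uniform mul1r nat1r -subSn.
apply: lerD.
  have /andP[l0 l1] := left_free_itv m k.
  by rewrite ger0_norm ?subr_ge0 // lerBlDr lerDl.
rewrite normrM ger0_norm ?uniform_ge0 // ler_wpM2l ?uniform_ge0 //.
apply: le_trans (ler_norm_sum _ _ _) _.
have -> : K%:R * (K - k.+1)%:R = \sum_(j < K) (K - k.+1)%:R :> R.
  by rewrite sumr_const card_ord mulr_natl.
rewrite [leLHS]big_mkcond; apply: ler_sum => j _; case: ltnP => // kj.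
have := ltn_ord j; have := ltn_ord k => ltk ltj.
by apply: le_trans (IH j _) _; rewrite ?ler_nat; lia.
Qed.

End BlockingLimits.

Section Asymptotics.
Variables (R : realFieldType) (K : nat) (v : nat -> R).
Hypothesis K_gt0 : (0 < K)%N.
Hypothesis v1_ge0 : 0 <= v 1%N.
Hypothesis v_incr : forall k, (1 <= k < K)%N -> v k < v k.+1.

Local Notation p := (K%:R^-1 : R).
Local Notation left_limit := (left_limit R K).
Local Notation right_limit := (right_limit R K).
Local Notation right_limit_itv := (right_limit_itv R K_gt0).
Local Notation left_free_itv := (left_free_itv R K_gt0).
Local Notation left_free_cesaro := (left_free_cesaro R K_gt0).
Local Notation E := (iid_expectation K v (fun=> p)).
Local Notation value_ge0 := (value_ge0 K_gt0 v1_ge0 v_incr).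
Local Notation uniform_ge0 := (uniform_ge0 R K).
Local Notation sum_uniform := (sum_uniform R K_gt0).

(** Blocking from the right propagates along strictly increasing weights, so it depends on at most
    [K - k.+1] further edges. *)
Lemma right_free_stationary m (k : 'I_K) :
  (K <= m + k.+1)%N -> right_free v m k = right_limit k.
Proof.
elim: m k => [|m IH] k mk.
  by rewrite right_free0 // /right_limit (_ : K - k.+1 = 0)%N //; lia.
rewrite right_freeS // right_limitE //; congr (1 - _ * _).
by apply: eq_bigr => j kj; apply: IH; lia.
Qed.

Lemma right_free_itv m (k : 'I_K) : 0 <= right_free v m k <= 1.
Proof.
have p0 j : (j < K)%N -> 0 <= p by rewrite uniform_ge0.
apply/andP; split.
  rewrite -(iid_expectation_cst v (p := fun=> p) sum_uniform m 0).
  by apply: (le_iid_expectation (p := fun=> p) p0) => t _; case: (~~ _).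
rewrite -[leRHS](iid_expectation_cst v (p := fun=> p) sum_uniform m).
apply: (le_iid_expectation (p := fun=> p) p0) => t _.
by case: (~~ _); rewrite ?lexx ?ler01.
Qed.

Definition greedy_rate : R :=
  p * \sum_(k < K) v k.+1 * (left_limit k * right_limit k).

(** The right factor equals its limit except at no more than [K] positions near the right end; the
    left factor is then handled by its Cesaro bound. Each replacement costs at most [K]. *)
Lemma free_product_cesaro m (k : 'I_K) :
  `|\sum_(t < m.+1) left_free R t k * right_free v (m - t) k -
    m.+1%:R * (left_limit k * right_limit k)| <= K%:R + K%:R.
Proof.
have /andP[r0 r1] := right_limit_itv k.
have -> : \sum_(t < m.+1) left_free R t k * right_free v (m - t) k -
    m.+1%:R * (left_limit k * right_limit k) =
    \sum_(t < m.+1) left_free R t k * (right_free v (m - t) k - right_limit k) +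
    (\sum_(t < m.+1) left_free R t k - m.+1%:R * left_limit k) * right_limit k.
  rewrite mulrBl mulr_suml addrA -big_split mulrA; congr (_ - _).
  by apply: eq_bigr => t _ /=; ring.
apply: le_trans (ler_normD _ _) (lerD _ _); last first.
  rewrite normrM [X in _ * X]ger0_norm // -[leRHS]mulr1 ler_pM //.
  by apply: le_trans (left_free_cesaro _ _) _; rewrite ler_nat leq_subr.
apply: le_trans (ler_norm_sum _ _ _) _.
apply: (@le_trans _ _ (\sum_(t < m.+1) (m - t < K)%N%:R)).
  apply: ler_sum => t _; case: ltnP => mt; last first.
    by rewrite right_free_stationary ?subrr ?mulr0 ?normr0 //; lia.
  rewrite normrM; have /andP[l0 l1] := left_free_itv t k.
  have /andP[f0 f1] := right_free_itv (m - t) k.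
  rewrite -[leRHS]mul1r ler_pM //; first by rewrite ger0_norm.
  by rewrite ler_norml; apply/andP; split; rewrite /=; lra.
rewrite -natr_sum ler_nat (reindex_inj rev_ord_inj) /=.
rewrite (eq_bigr (fun t : 'I_m.+1 => (t < K : nat))); last first.
  by move=> t _; congr (nat_of_bool (_ < _)%N); have := ltn_ord t; lia.
suff : (\sum_(t < m.+1) (t < K) <= minn m.+1 K)%N by move/leq_trans; apply; lia.
elim: m.+1 => [|n IH]; first by rewrite big_ord0.
rewrite big_ord_recr /=; apply: leq_trans (leq_add IH (leqnn _)) _.
by case: (ltnP n K) => /=; lia.
Qed.

Lemma greedy_weight_asymptotic : exists C, forall m,
  `|E m (greedy_weight false) - m%:R * greedy_rate| <= C.
Proof.
exists (p * \sum_(k < K) v k.+1 * (K%:R + K%:R)) => -[|m].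
  rewrite iid_expectation0 mul0r subrr normr0 mulr_ge0 ?uniform_ge0 //.
  by rewrite sumr_ge0 // => k _; rewrite mulr_ge0 ?value_ge0 ?addr_ge0.
rewrite iid_expectation_greedy_weight // /greedy_rate mulrCA -mulrBr normrM.
rewrite ger0_norm ?uniform_ge0 // ler_wpM2l ?uniform_ge0 // mulr_sumr -sumrB.
apply: (le_trans (ler_norm_sum _ _ _)); apply: ler_sum => k _.
rewrite mulrCA -mulrBr normrM ger0_norm ?value_ge0 // ler_wpM2l ?value_ge0 //.
exact: free_product_cesaro.
Qed.

End Asymptotics.

(** * Upper bound on the expected optimum *)

Section OptimumExpectation.
Variables (R : realFieldType) (K : nat) (v : nat -> R).
Hypothesis K_gt0 : (0 < K)%N.
Hypothesis v_incr : forall k, (1 <= k < K)%N -> v k < v k.+1.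

Local Notation p := (K%:R^-1 : R).
Local Notation E := (iid_expectation K v (fun=> p)).
Local Notation value_le := (value_le v_incr).
Local Notation uniform_ge0 := (uniform_ge0 R K).
Local Notation natr_mul_uniform := (natr_mul_uniform R K_gt0).
Local Notation sum_uniform := (sum_uniform R K_gt0).

(** The convention [v_0 = 0] makes the increments sum back to the values. *)
Definition increment (k : nat) : R := if k is 0%N then v 1%N else v k.+1 - v k.

Lemma sum_increment (j : 'I_K) :
  v j.+1 = \sum_(k < K) increment k * (k <= j)%N%:R.
Proof.
transitivity (\sum_(k < K | (k < j.+1)%N) increment k).
  rewrite -(big_ord_widen _ increment) ?ltn_ord //.
  elim: (val j) => [|i IH]; first by rewrite big_ord1.
  by rewrite big_ord_recr -IH /= addrC subrK.
rewrite big_mkcond; apply: eq_bigr => k _.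
by rewrite ltnS; case: leqP => _; rewrite ?mulr1 ?mulr0.
Qed.

Lemma sum_by_increments (y : nat -> R) :
  \sum_(j < K) v j.+1 * y j =
  \sum_(k < K) increment k * \sum_(j < K | (k <= j)%N) y j.
Proof.
under eq_bigr => j _ do rewrite sum_increment mulr_suml.
rewrite exchange_big; apply: eq_bigr => k _; rewrite mulr_sumr.
rewrite [RHS]big_mkcond; apply: eq_bigr => j _ /=.
by case: leqP => _; rewrite ?mulr1 ?mulr0 ?mul0r.
Qed.

(* With q = (K - k) / K the probability that an edge has weight at least
   [v k.+1], this is q / (1 + q): the limit density of a maximum cardinality
   matching in the random subgraph of these edges. *)
Definition tail_rate (k : nat) : R := (K - k)%:R / (K%:R + (K - k)%:R).

(** With these 0/1 weights, [opt] is the maximum cardinality of a matching using only edges of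
    weight at least [v k.+1]. *)
Definition at_least (k : nat) (s : seq R) : seq R :=
  [seq (v k.+1 <= w)%R%:R | w <- s].

(** For 0/1 weights the gain stays between 0 and 1, so it is one minus the gain of the tail if the
    first edge is present, and 0 otherwise. *)
Lemma iid_expectation_gain m (k : 'I_K) :
  E m.+1 (fun s => gain (at_least k s)) =
  p * (K - k)%:R * (1 - E m (fun s => gain (at_least k s))).
Proof.
rewrite iid_expectationS -mulr_sumr -mulrA; congr (_ * _).
have -> : (K - k)%:R = \sum_(j < K) (k <= j)%N%:R :> R.
  rewrite -natr_sum -[(K - k)%N]muln1 -sum_nat_const_nat big_geq_mkord big_mkcond.
  by congr _%:R; apply: eq_bigr => j _; case: leqP.
rewrite mulr_suml; apply: eq_bigr => j _.
rewrite -[X in X - _](iid_expectation_cst v (p := fun=> p) sum_uniform m).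
rewrite -[X in _ + X]mulN1r -iid_expectationZ -iid_expectationD -iid_expectationZ.
apply: eq_iid_expectation => t _ /=; rewrite value_le mulN1r.
have g0 := gain_ge0 (at_least k [seq v (val j).+1 | j <- t]).
have g1 : gain (at_least k [seq v (val j).+1 | j <- t]) <= 1.
  case: t {g0} => [|i t] /=; first exact: ler01.
  rewrite ge_max ler01 lerBlDr.
  by rewrite ler_wpDr ?gain_ge0 // value_le; case: leqP; rewrite ?lexx ?ler01.
case: leqP => _; first by rewrite mul1r max_r // subr_ge0.
by rewrite mul0r max_l // sub0r oppr_le0.
Qed.

Lemma iid_expectation_opt_at_least m (k : 'I_K) :
  E m (fun s => opt (at_least k s)) <= m.+1%:R * tail_rate k.
Proof.
pose q : R := p * (K - k)%:R; pose sigma m := E m (fun s => gain (at_least k s)).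
pose S m := E m (fun s => opt (at_least k s)).
have sigmaS i : sigma i.+1 = q * (1 - sigma i) by exact: iid_expectation_gain.
have SS i : S i.+1 = sigma i.+1 + S i.
  have -> : S i = \sum_(j < K) p * S i by rewrite -mulr_suml sum_uniform mul1r.
  rewrite /S /sigma !iid_expectationS -big_split.
  by apply: eq_bigr => j _ /=; rewrite -mulrDr -iid_expectationD.
have q0 : 0 <= q by rewrite mulr_ge0 ?uniform_ge0.
have q1 : q <= 1.
  by rewrite /q -[leRHS]natr_mul_uniform mulrC ler_wpM2r ?uniform_ge0 // ler_nat leq_subr.
have s01 i : 0 <= sigma i <= 1.
  elim: i => [|i /andP[s0 s1]]; first by rewrite /sigma iid_expectation0 lexx ler01.
  rewrite sigmaS mulr_ge0 ?subr_ge0 //= -[leRHS]mulr1.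
  by rewrite ler_pM ?subr_ge0 // lerBlDr lerDl.
have -> : tail_rate k = q / (1 + q).
  rewrite /tail_rate /q; have K0 : K%:R != 0 :> R by rewrite pnatr_eq0 -lt0n.
  have K1 : K%:R + (K - k)%:R != 0 :> R by rewrite -natrD pnatr_eq0; lia.
  by field; rewrite K0 K1.
rewrite mulrA ler_pdivlMr; last by rewrite ltr_pwDl.
(* The recursion of [sigma] telescopes in [S]; the remainder [q * sigma m] is at most [q], whence
   [m.+1] in the bound. *)
have -> : S m * (1 + q) = q * m%:R + q * sigma m.
  elim: m => [|m IH].
    by rewrite /S /sigma !iid_expectation0 /=; ring.
  by rewrite SS mulrDl IH sigmaS -natr1; ring.
rewrite -natr1 mulrDl mul1r [m%:R * q]mulrC lerD2l -[leRHS]mulr1 ler_wpM2l //.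
by case/andP: (s01 m).
Qed.

Definition optimum_rate_bound : R := \sum_(k < K) increment k * tail_rate k.

(** Telescoping: the summand is [K / (2K - j - 1) - K / (2K - j)]. *)
Lemma sum_tail_rate k : (k <= K)%N ->
  \sum_(j < K | (k <= j)%N) K%:R / ((2 * K%:R - j%:R) * (2 * K%:R - j.+1%:R)) =
  tail_rate k :> R.
Proof.
move=> kK; rewrite -(big_geq_mkord k K xpredT
  (fun j => K%:R / ((2 * K%:R - j%:R) * (2 * K%:R - j.+1%:R)))).
rewrite -{1}(subKn kK) /tail_rate; elim: (K - k)%N (leq_subr k K) => [|n IH] nK.
  by rewrite subn0 big_geq // mul0r.
rewrite big_ltn; last by lia.
rewrite (_ : (K - n.+1).+1 = K - n)%N ?IH; [|lia|lia].
rewrite !natrB //; last by lia.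
have K0 : K%:R != 0 :> R by rewrite pnatr_eq0 -lt0n.
have n0 : K%:R + n%:R != 0 :> R by rewrite -natrD pnatr_eq0; lia.
have n1 : K%:R + n.+1%:R != 0 :> R by rewrite -natrD pnatr_eq0; lia.
rewrite -natr1 in n1 * => /=; field.
by rewrite n0 n1.
Qed.

Lemma PR_bound_denominator :
  \sum_(1 <= k < K.+1)
    v k * (K%:R / ((2 * K%:R + 1 - k%:R) * (2 * K%:R - k%:R))) =
  optimum_rate_bound.
Proof.
rewrite big_add1 /= big_mkord.
pose y (j : nat) : R := K%:R / ((2 * K%:R - j%:R) * (2 * K%:R - j.+1%:R)).
rewrite (eq_bigr (fun j : 'I_K => v j.+1 * y j)); last first.
  move=> j _; rewrite /y; congr (_ * (_ / (_ * _))).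
  by rewrite -natr1; ring.
rewrite sum_by_increments; apply: eq_bigr => k _.
by rewrite sum_tail_rate // ltnW.
Qed.

(** The powers of [K] in the two limits cancel against the factor [p]. *)
Lemma PR_bound_numerator :
  \sum_(1 <= k < K.+1)
    v k * ((K%:R - 1) ^+ (K - k) / (K%:R + 1) ^+ (K - k + 1)) =
  greedy_rate K v.
Proof.
have K0 : K%:R != 0 :> R by rewrite pnatr_eq0 -lt0n.
have K1 : K%:R + 1 != 0 :> R by rewrite natr1 pnatr_eq0.
rewrite big_add1 /= big_mkord /greedy_rate mulr_sumr; apply: eq_bigr => j _.
rewrite [RHS]mulrCA; congr (_ * _); rewrite /left_limit /right_limit.
rewrite -(subnSK (ltn_ord j)) addn1 -[K.+1%:R]natr1.
have -> : 1 - p = (K%:R - 1) / K%:R by field.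
rewrite !exprMn !exprVn !exprS; field.
by rewrite K0 K1 !expf_neq0.
Qed.

Hypothesis v1_ge0 : 0 <= v 1%N.

Lemma increment_ge0 (k : 'I_K) : 0 <= increment k.
Proof.
by case: k => -[|k] kK //=; rewrite subr_ge0 ltW // v_incr.
Qed.

Lemma iid_expectation_opt_le m : E m (@opt R) <= m.+1%:R * optimum_rate_bound.
Proof.
have p0 j : (j < K)%N -> 0 <= p by rewrite uniform_ge0.
apply: (@le_trans _ _ (E m (fun s => \sum_(k < K) increment k * opt (at_least k s)))).
  apply: (le_iid_expectation (p := fun=> p) p0) => t _.
  apply: le_trans (opt_sum (g := fun (k j : 'I_K) => (k <= j)%N%:R)
    increment_ge0 (fun j _ => sum_increment j)) _.
  rewrite le_eqVlt; apply/orP; left; apply/eqP/eq_bigr => k _; congr (_ * opt _).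
  by rewrite /at_least -map_comp; apply: eq_map => j /=; rewrite value_le.
rewrite iid_expectation_sum mulr_sumr; apply: ler_sum => k _.
rewrite iid_expectationZ mulrCA ler_wpM2l ?increment_ge0 //.
exact: iid_expectation_opt_at_least.
Qed.

End OptimumExpectation.

(** * The closed-form bound *)

Section RatioBound.
Variables (R : realFieldType) (K : nat).
Hypothesis K_gt0 : (0 < K)%N.

Local Notation r := ((K%:R - 1) / (K%:R + 1) : R).

Lemma natr_succ_gt0 : 0 < K%:R + 1 :> R.
Proof. by rewrite natr1 ltr0n. Qed.

Lemma ratio_ge0 : 0 <= r.
Proof. by rewrite divr_ge0 ?(ltW natr_succ_gt0) // subr_ge0 ler1n. Qed.

Lemma ratio_lt1 : r < 1.
Proof. by rewrite ltr_pdivrMr ?natr_succ_gt0 // mul1r; lra. Qed.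

(** Writing [A l] for the bracket, [r * A (l + 1) <= A l], because [(K + 1) A l - (K - 1) A (l + 1)]
    is the square of [2 (l + 1)]. *)
Lemma ratio_expn_le l :
  r ^+ l * (K%:R * (K%:R + 1) + 2 * l%:R * (K%:R + l%:R + 1)) <= K%:R * (K%:R + 1).
Proof.
elim: l => [|l IH]; first by rewrite expr0 mulr0 mul0r addr0 mul1r.
apply: le_trans IH; rewrite exprSr -mulrA ler_wpM2l ?exprn_ge0 ?ratio_ge0 //.
rewrite mulrAC ler_pdivrMr ?natr_succ_gt0 // -subr_ge0 -[l.+1%:R]natr1.
have -> : (K%:R * (K%:R + 1) + 2 * l%:R * (K%:R + l%:R + 1)) * (K%:R + 1) -
    (K%:R - 1) * (K%:R * (K%:R + 1) +
      2 * (l%:R + 1) * (K%:R + (l%:R + 1) + 1)) = (2 * (l%:R + 1)) ^+ 2 :> R by ring.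
exact: sqr_ge0.
Qed.

(* Equivalently, (1 - r^l) (K + l) / l is nonincreasing in l. *)
Lemma ratio_step l :
  (1 - r ^+ l.+1) * (K%:R + l.+1%:R) * l%:R <= (1 - r ^+ l) * (K%:R + l%:R) * l.+1%:R.
Proof.
have K1 := natr_succ_gt0; have K1n : K%:R + 1 != 0 :> R by rewrite gt_eqF.
rewrite -subr_ge0 exprSr -[l.+1%:R]natr1; set rl := r ^+ l.
have -> : (1 - rl) * (K%:R + l%:R) * (l%:R + 1) -
    (1 - rl * r) * (K%:R + (l%:R + 1)) * l%:R =
    (K%:R * (K%:R + 1) - rl * (K%:R * (K%:R + 1) +
    2 * l%:R * (K%:R + l%:R + 1))) / (K%:R + 1) :> R by field.
by rewrite divr_ge0 ?(ltW K1) // subr_ge0 ratio_expn_le.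
Qed.

(** Downward induction from [l = K], where both sides agree, along the monotone quotient of
    [ratio_step]. *)
Lemma ratio_tail l : (l <= K)%N ->
  (1 - r ^+ K) * (2 * l%:R) <= (1 - r ^+ l) * (K%:R + l%:R).
Proof.
move=> lK; rewrite -(subKn lK); elim: (K - l)%N (leq_subr l K) => [|d IH] dK.
  by rewrite subn0 -mulr2n mulr_natl.
set l' := (K - d.+1)%N; have lE : (K - d = l'.+1)%N by rewrite /l'; lia.
have := IH (ltnW dK); rewrite lE => IH'.
have l1 : 0 < l'.+1%:R :> R by rewrite ltr0n.
rewrite -(ler_pM2r l1); apply: le_trans (ratio_step l').
rewrite [leLHS](_ : _ = (1 - r ^+ K) * (2 * l'.+1%:R) * l'%:R); last by ring.
by rewrite ler_wpM2r.
Qed.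

Lemma ratio_bound_gt0 : 0 < 1 - r ^+ K.
Proof. by rewrite subr_gt0 exprn_ilt1 ?ratio_ge0 ?ratio_lt1 // -lt0n. Qed.

Variable v : nat -> R.

Lemma sum_increment_last : \sum_(k < K) increment v k = v K.
Proof.
have lt : (K.-1 < K)%N by rewrite prednK.
have := sum_increment v (Ordinal lt); rewrite /= prednK // => ->.
apply: eq_bigr => k _; have -> : (k <= K.-1)%N by have := ltn_ord k; lia.
by rewrite mulr1.
Qed.

Lemma PR_boundE : PR_bound K v = greedy_rate K v / optimum_rate_bound K v.
Proof. by rewrite /PR_bound PR_bound_numerator // PR_bound_denominator. Qed.

(** Abel summation leaves a geometric tail for each increment, and [(1 - r) (K + 1) = 2]. *)
Lemma greedy_rateE :
  greedy_rate K v = \sum_(k < K) increment v k * ((1 - r ^+ (K - k)) / 2).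
Proof.
have K1 := natr_succ_gt0; have K1n : K%:R + 1 != 0 :> R by rewrite gt_eqF.
rewrite -PR_bound_numerator // big_add1 /= big_mkord.
rewrite (eq_bigr (fun j : 'I_K => v j.+1 * (r ^+ (K - j.+1) / (K%:R + 1)))).
  rewrite (sum_by_increments K v (fun j => r ^+ (K - j.+1) / (K%:R + 1))).
  apply: eq_bigr => k _; congr (_ * _); rewrite -mulr_suml.
  rewrite -sum_geometric_tail ?(ltnW (ltn_ord k)) //.
  by set S := \sum_(_ < _ | _) _; field.
by move=> j _; congr (_ * _); rewrite exprMn exprVn addn1 exprSr invfM mulrA.
Qed.

Hypothesis v1_ge0 : 0 <= v 1%N.
Hypothesis v_incr : forall k, (1 <= k < K)%N -> v k < v k.+1.

Local Notation increment_ge0 := (increment_ge0 v_incr v1_ge0).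

Lemma ratio_rate_le : (1 - r ^+ K) * optimum_rate_bound K v <= greedy_rate K v.
Proof.
rewrite greedy_rateE mulr_sumr; apply: ler_sum => k _.
rewrite mulrCA ler_wpM2l ?increment_ge0 // ler_pdivlMr // /tail_rate -mulrA.
rewrite [_ / _ * 2]mulrAC mulrA ler_pdivrMr ?[_ * 2]mulrC ?ratio_tail ?leq_subr //.
by rewrite ltr_pwDl ?ltr0n.
Qed.

(** Each [tail_rate] is at least [1 / (2K)], and the increments sum to [v K]. *)
Lemma optimum_rate_bound_gt0 : 0 < v K -> 0 < optimum_rate_bound K v.
Proof.
move=> vK; have K2 : 0 < K%:R + K%:R :> R by rewrite addr_gt0 ?ltr0n.
apply: (@lt_le_trans _ _ (v K / (K%:R + K%:R))); first exact: divr_gt0.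
rewrite -sum_increment_last mulr_suml; apply: ler_sum => k _.
rewrite ler_wpM2l ?increment_ge0 // /tail_rate -[leLHS]mul1r.
have ltk := ltn_ord k.
by rewrite ler_pM ?invr_ge0 ?(ltW K2) ?ler1n ?subn_gt0 // lef_pV2 ?posrE ?ltr_pwDl ?ltr0n //
  lerD2l ler_nat leq_subr.
Qed.

Lemma PR_bound_ge : 0 < v K -> 1 - r ^+ K <= PR_bound K v.
Proof.
move=> vK; rewrite PR_boundE ler_pdivlMr ?optimum_rate_bound_gt0 //.
exact: ratio_rate_le.
Qed.

(** The numerator is at most [v K (1 - r^K) / 2], and the first increment alone brings the
    denominator to [v 1 / 2]. *)
Lemma PR_bound_le : 0 < v 1%N -> PR_bound K v <= v K / v 1%N * (1 - r ^+ K).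
Proof.
move=> v1; have K0 : 0 < K%:R :> R by rewrite ltr0n.
have D0 : v 1%N / 2 <= optimum_rate_bound K v.
  have inc0 : increment v (Ordinal K_gt0) = v 1%N by [].
  rewrite /optimum_rate_bound (bigD1 (Ordinal K_gt0)) //= ler_wpDr.
  - by [].
  - rewrite sumr_ge0 // => k _; rewrite mulr_ge0 ?increment_ge0 //.
    by rewrite divr_ge0 ?addr_ge0.
  rewrite le_eqVlt; apply/orP; left; rewrite /tail_rate subn0.
  by apply/eqP; field; rewrite -mulr2n; lra.
have v2 : 0 < v 1%N / 2 by rewrite divr_gt0.
rewrite PR_boundE ler_pdivrMr ?(lt_le_trans v2) //.
have vK0 : 0 <= v K by rewrite -sum_increment_last sumr_ge0 // => k _; exact: increment_ge0.
have c0 : 0 <= v K / v 1%N * (1 - r ^+ K).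
  by rewrite mulr_ge0 ?divr_ge0 ?(ltW ratio_bound_gt0).
apply: le_trans (ler_wpM2l c0 D0).
rewrite [leRHS](_ : _ = v K * ((1 - r ^+ K) / 2)); last by field; rewrite gt_eqF.
rewrite greedy_rateE -sum_increment_last mulr_suml; apply: ler_sum => k _.
rewrite ler_wpM2l ?increment_ge0 // ler_pM2r // lerD2l lerN2.
by rewrite ler_wiXn2l ?ratio_ge0 ?(ltW ratio_lt1) // leq_subr.
Qed.

End RatioBound.

(** * Comparison with the exponential and the numerical value of its bound *)

Section ExponentialBounds.
Variable R : realType.
Implicit Types (x : R) (n : nat).

(** Both sides agree at 0, and their difference has derivative [y (e^y - e^(-y))], which is
    nonnegative for [y >= 0]. *)
Lemma expR_cayley x : 0 <= x -> (1 - x) * expR x <= (1 + x) * expR (- x).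
Proof.
move=> x0; pose f (y : R) : R := (1 + y) * expR (- y) - (1 - y) * expR y.
have df (y : R) : is_derive y 1 f (y * (expR y - expR (- y))).
  apply: is_derive_eq; rewrite /GRing.scale /=; ring.
have : f 0 <= f x.
  apply: (@ger0_derive1_ndecry _ f 0) => // [y|].
  - rewrite in_itv /= andbT => y0; rewrite derive1E; have [_ ->] := df y.
    by rewrite mulr_ge0 ?(ltW y0) // subr_ge0 ler_expR; lra.
  - apply: continuous_subspaceT => y; apply/differentiable_continuous.
    by apply/derivable1_diffP; exact: ex_derive.
by rewrite /f oppr0 !addr0 subrr subr_ge0.
Qed.

Lemma ratio_expn_le_expR n : (0 < n)%N ->
  ((n%:R - 1) / (n%:R + 1)) ^+ n <= expR (- 2) :> R.
Proof.
move=> n0; have n1 : 0 < n%:R :> R by rewrite ltr0n.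
have -> : - 2 = n%:R * (- (2 / n%:R)) :> R by field; rewrite gt_eqF.
rewrite expRM_natl lerXn2r ?nnegrE ?expR_ge0 //.
  by rewrite divr_ge0 ?subr_ge0 ?ler1n // addr_ge0.
(* At [x = 1/n] this reads [(n - 1) / (n + 1) <= e^(-2/n)] after multiplication by [n e^(-1/n)]. *)
have := expR_cayley (ltW (_ : 0 < n%:R^-1)); rewrite invr_gt0 => /(_ n1).
have -> : - (2 / n%:R) = - n%:R^-1 - n%:R^-1 :> R by field; rewrite gt_eqF.
rewrite expRD => h; rewrite ler_pdivrMr ?addr_gt0 //.
have EF := expRxMexpNx_1 (n%:R^-1 : R); move: h EF.
set E := expR n%:R^-1; set F := expR (- n%:R^-1) => h EF.
have xn : n%:R^-1 * n%:R = 1 :> R by rewrite mulVf // gt_eqF.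
have Fn : 0 <= F * n%:R by rewrite mulr_ge0 ?expR_ge0.
have := ler_wpM2r Fn h.
rewrite (_ : _ * _ * _ = (n%:R - n%:R^-1 * n%:R) * (E * F)); last by ring.
rewrite EF xn mulr1 => /le_trans; apply.
rewrite (_ : _ * _ * _ = F * F * (n%:R + n%:R^-1 * n%:R)); last by ring.
by rewrite xn.
Qed.

Lemma expR_series_le n x : 0 <= x -> \sum_(0 <= k < n) exp_coeff x k <= expR x.
Proof.
move=> x0; apply: (nondecreasing_cvgn_le (u_ := series (exp_coeff x))).
  by apply: nondecreasing_series => k _ _; exact: exp_coeff_ge0.
exact: is_cvg_series_exp_coeff.
Qed.

Lemma expRN2_approx : `|(1 - expR (- 2)) - 865%:R / 1000%:R| < 1 / 2000%:R :> R.
Proof.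
(* The claim places [e^(-2)] in (0.1345, 0.1355). The power [(11/13)^12] bounds it from below, and
   eight terms of the series of [e^2] bound it from above. *)
have lb : 673 / 5000 <= expR (- 2) :> R.
  apply: le_trans (ratio_expn_le_expR (n := 12) _) => //.
  have -> : (12%:R - 1) / (12%:R + 1) = 11 / 13 :> R by congr (_ / _); ring.
  by rewrite !exprS expr0; lra.
have ub : expR (- 2) <= 71 / 524 :> R.
  rewrite expRN -[leRHS]invf_div lef_pV2 ?posrE ?expR_gt0 ?divr_gt0 //.
  apply: le_trans (expR_series_le 8 _) => //.
  rewrite !big_nat_recr //= big_geq // /exp_coeff /= !factS fact0.
  rewrite !exprS expr0; lra.
by rewrite ltr_norml; apply/andP; split; lra.
Qed.

End ExponentialBounds.

(** * Convergence of the performance ratio *)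

Section Limits.
Local Open Scope classical_set_scope.
Variable R : realType.
Implicit Types u : nat -> R.

Lemma cvg_div_natr (C : R) : (fun n => C / n%:R) @ \oo --> (0 : R).
Proof.
rewrite -cvg_shiftS.
have := cvgM (cvg_cst C) (@cvg_harmonic R).
rewrite mulr0; exact.
Qed.

Lemma linear_asymptotic_cvg u (l C : R) :
  (forall n, `|u n - n%:R * l| <= C) -> (fun n => u n / n%:R) @ \oo --> l.
Proof.
move=> uC; apply/cvgrPdist_le => e e0.
have /cvgrPdist_le/(_ e e0) := cvg_div_natr C.
apply: filterS2 (nbhs_infty_gt 0) => n n0.
rewrite sub0r normrN => /(le_trans (ler_norm _)) h; apply: le_trans h.
have nn : 0 < n%:R :> R by rewrite ltr0n.
rewrite ler_pdivlMr // -[X in _ * X]ger0_norm // -normrM mulrBl divfK ?gt_eqF //.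
by rewrite distrC mulrC.
Qed.

(** The limit is the infimum of [u n / n] over positive [n]: divide [n] by an index that nearly
    attains it; the remainder contributes a bounded term. *)
Lemma fekete u : (forall n, 0 <= u n) ->
  (forall m n, u (m + n)%N <= u m + u n) -> cvgn (fun n => u n / n%:R).
Proof.
move=> u0 uD; pose A := [set u n.+1 / n.+1%:R | n in setT].
have Alb : lbound A 0 by move=> _ [n _ <-]; rewrite divr_ge0.
have Ainf : has_inf A by split; [exists (u 1%N / 1); exists 0%N | exists 0].
apply/cvg_ex; exists (inf A); apply/cvgrPdist_le => e e0.
have e2 : 0 < e / 2 by rewrite divr_gt0.
have [_ [p _ <-] up] := inf_adherent e2 Ainf.
have p0 : 0 < p.+1%:R :> R by rewrite ltr0n.
have u1 n : u n <= u 0%N + n%:R * u 1%N.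
  elim: n => [|n IH]; first by rewrite mul0r addr0.
  rewrite -addn1 natrD mulrDl mul1r addrA.
  by apply: le_trans (uD _ _) _; rewrite lerD2r.
pose C := u 0%N + p.+1%:R * u 1%N.
have uq q r : u (q * p.+1 + r)%N <= q%:R * u p.+1 + u r.
  elim: q => [|q IH]; first by rewrite mul0n mul0r add0r add0n.
  rewrite mulSn -addnA -natr1 mulrDl mul1r addrAC.
  by apply: le_trans (uD _ _) _; rewrite [leLHS]addrC lerD2r.
have uC n : u n <= n%:R * (u p.+1 / p.+1%:R) + C.
  rewrite {1}(divn_eq n p.+1); apply: le_trans (uq _ _) (lerD _ _).
    rewrite mulrCA mulrC ler_wpM2l ?u0 // ler_pdivlMr // -natrM ler_nat.
    exact: leq_trunc_div.
  apply: le_trans (u1 _) _; rewrite lerD2l ler_wpM2r // ler_nat ltnW //.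
  exact: ltn_pmod.
have /cvgrPdist_le/(_ _ e2) := cvg_div_natr C.
apply: filterS2 (nbhs_infty_gt 0) => -[//|n] _.
rewrite sub0r normrN => /(le_trans (ler_norm _)) Cn.
have nn : 0 < n.+1%:R :> R by rewrite ltr0n.
have le1 : inf A <= u n.+1 / n.+1%:R.
  by apply: ge_inf; [exists 0 | exists n].
have le2 : u n.+1 / n.+1%:R <= u p.+1 / p.+1%:R + C / n.+1%:R.
  rewrite ler_pdivrMr // mulrDl divfK ?gt_eqF // [_ / _ * _]mulrC.
  exact: uC.
rewrite distrC ger0_norm ?subr_ge0 // lerBlDr; apply: le_trans le2 _.
by have := lerD (ltW up) Cn; rewrite -addrA -splitr [_ + e]addrC.
Qed.

End Limits.

Section PerformanceRatio.
Local Open Scope classical_set_scope.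
Variables (R : realType) (K : nat) (v : nat -> R).
Hypothesis K_gt0 : (0 < K)%N.
Hypothesis v1_ge0 : 0 <= v 1%N.
Hypothesis v_incr : forall k, (1 <= k < K)%N -> v k < v k.+1.
Hypothesis vK_gt0 : 0 < v K.

Local Notation p := (K%:R^-1 : R).
Local Notation E := (iid_expectation K v (fun=> p)).
Local Notation values_ge0 := (values_ge0 K_gt0 v1_ge0 v_incr).

Let p0 j : (j < K)%N -> 0 <= p. Proof. by rewrite uniform_ge0. Qed.

Lemma path_PR_succ m :
  path_PR K v (fun=> p) m.+1 = E m (greedy_weight false) / E m (@opt R).
Proof.
congr (_ / _); apply: eq_iid_expectation => t tm.
  by apply: fhat_greedy_weight; [rewrite size_map | exact: values_ge0].
by rewrite fstar_path // size_map.
Qed.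

Lemma greedy_mean_cvg :
  (fun m => E m (greedy_weight false) / m%:R) @ \oo --> greedy_rate K v.
Proof.
have [C] := greedy_weight_asymptotic K_gt0 v1_ge0 v_incr.
exact: linear_asymptotic_cvg.
Qed.

(** Consecutive blocks of weights are independent, so the subadditivity of [opt] passes to its
    expectation. *)
Lemma opt_mean_is_cvg : cvgn (fun m => E m (@opt R) / m%:R).
Proof.
apply: fekete => [m|m1 m2].
  rewrite -(iid_expectation_cst v (p := fun=> p) (sum_uniform R K_gt0) m 0).
  by apply: (le_iid_expectation (p := fun=> p) p0) => t _; exact: opt_ge0.
rewrite iid_expectation_cat.
apply: (@le_trans _ _ (E m1 (fun s => opt s + E m2 (@opt R)))).
  apply: (le_iid_expectation (p := fun=> p) p0) => s _.
  rewrite -[X in X + _](iid_expectation_cst v (p := fun=> p) (sum_uniform R K_gt0) m2).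
  rewrite -iid_expectationD.
  by apply: (le_iid_expectation (p := fun=> p) p0) => t _; exact: opt_cat.
by rewrite iid_expectationD (iid_expectation_cst v (p := fun=> p) (sum_uniform R K_gt0)).
Qed.

Lemma opt_mean_lim_le :
  limn (fun m => E m (@opt R) / m%:R) <= optimum_rate_bound K v.
Proof.
have D0 := optimum_rate_bound_gt0 K_gt0 v1_ge0 v_incr vK_gt0.
set D := optimum_rate_bound K v in D0 *.
have cD : (fun m : nat => D + D / m%:R) @ \oo --> D.
  rewrite -[X in _ --> X]addr0; apply: cvgD (cvg_div_natr D).
  exact: cvg_cst.
apply: (ler_cvg_to opt_mean_is_cvg cD).
apply: filterS (nbhs_infty_gt 0) => m m0 /=.
have mm : 0 < m%:R :> R by rewrite ltr0n.
rewrite ler_pdivrMr // mulrDl divfK ?gt_eqF // mulrC -[X in _ + X]mul1r -mulrDl natr1.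
exact: iid_expectation_opt_le.
Qed.

(** As [greedy_rate] is positive, this keeps the limit of the optimum away from 0, which the
    quotient of limits requires. *)
Lemma greedy_rate_le_opt_mean_lim :
  greedy_rate K v <= limn (fun m => E m (@opt R) / m%:R).
Proof.
apply: (ler_cvg_to greedy_mean_cvg opt_mean_is_cvg).
apply: nearW => m; rewrite ler_wpM2r ?invr_ge0 //.
apply: (le_iid_expectation (p := fun=> p) p0) => t _.
by apply: greedy_weight_le_opt => i; exact: values_ge0.
Qed.

Lemma path_PR_cvg : path_PR K v (fun=> p) @ \oo -->
  greedy_rate K v / limn (fun m => E m (@opt R) / m%:R).
Proof.
have rate_gt0 : 0 < greedy_rate K v.
  apply: lt_le_trans (ratio_rate_le K_gt0 v1_ge0 v_incr).
  by rewrite mulr_gt0 ?ratio_bound_gt0 ?optimum_rate_bound_gt0.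
have lim_gt0 := lt_le_trans rate_gt0 greedy_rate_le_opt_mean_lim.
(* A path with [m.+1] users has [m] edges, so both expectations are divided by [m]. *)
rewrite -cvg_shiftS.
apply: cvg_trans; last first.
  apply: cvgM greedy_mean_cvg (cvgV (lt0r_neq0 lim_gt0) opt_mean_is_cvg).
apply: near_eq_cvg; apply: filterS (nbhs_infty_gt 0) => m m0 /=.
have mm : m%:R != 0 :> R by rewrite pnatr_eq0 -lt0n.
by rewrite path_PR_succ invfM invrK mulrACA mulVf // mulr1.
Qed.

Lemma PR_bound_le_lim : PR_bound K v <= limn (path_PR K v (fun=> p)).
Proof.
rewrite (cvg_lim _ path_PR_cvg) // PR_boundE //.
have D0 := optimum_rate_bound_gt0 K_gt0 v1_ge0 v_incr vK_gt0.
have N0 : 0 < greedy_rate K v.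
  apply: lt_le_trans (ratio_rate_le K_gt0 v1_ge0 v_incr).
  by rewrite mulr_gt0 ?ratio_bound_gt0.
rewrite ler_pM2l // lef_pV2 ?posrE //; first exact: opt_mean_lim_le.
exact: lt_le_trans N0 greedy_rate_le_opt_mean_lim.
Qed.

End PerformanceRatio.

(** The condition [0 < v K] excludes only [K = 1] with [v 1 = 0], where the ratio is 0/0. The
    tolerance 1/2000 expresses rounding to 86.5%, and the last clause is a limit uniform in [v]. *)
Theorem proposition5 (R : realType) (K : nat) (hK : (1 <= K)%N) :
  (forall v : nat -> R,
     0 <= v 1%N ->
     (forall k : nat, (1 <= k < K)%N -> v k < v k.+1) ->
     0 < v K ->
     let PR := path_PR K v (fun=> K%:R^-1) in
     [/\ cvgn PR,
         PR_bound K v <= limn PR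
       & 1 - ((K%:R - 1) / (K%:R + 1)) ^+ K <= PR_bound K v]) /\
  1 - expR (- 2) <= 1 - ((K%:R - 1) / (K%:R + 1)) ^+ K :> R /\
  `|(1 - expR (- 2)) - 865%:R / 1000%:R| < 1 / 2000%:R :> R /\
  (forall eps : R, 0 < eps ->
     exists2 delta : R, 0 < delta &
       forall v : nat -> R,
         0 < v 1%N ->
         (forall k : nat, (1 <= k < K)%N -> v k < v k.+1) ->
         v K / v 1%N < 1 + delta ->
         `|PR_bound K v - (1 - ((K%:R - 1) / (K%:R + 1)) ^+ K)| < eps).
Proof.
split=> [v v1 v_incr vK PR|].
  split; last exact: PR_bound_ge.
  - exact: cvgP (path_PR_cvg hK v1 v_incr vK).
  - exact: PR_bound_le_lim.
split; first by rewrite lerD2l lerN2 ratio_expn_le_expR.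
split=> [|eps eps0]; first exact: expRN2_approx.
(* [delta = eps] works: the deviation is at most [(v K / v 1 - 1) * rho], and [rho <= 1]. *)
exists eps => // v v1 v_incr vKe.
have v1K : v 1%N <= v K.
  have lt : (K.-1 < K)%N by rewrite prednK.
  by have := value_le v_incr (Ordinal hK) (Ordinal lt); rewrite /= prednK // => ->.
have vK : 0 < v K := lt_le_trans v1 v1K.
set rho := 1 - _; have rho0 : 0 < rho by exact: ratio_bound_gt0.
have rho1 : rho <= 1 by rewrite lerBlDr lerDl exprn_ge0 // ratio_ge0.
have lo : rho <= PR_bound K v := PR_bound_ge hK (ltW v1) v_incr vK.
have hi : PR_bound K v <= v K / v 1%N * rho := PR_bound_le hK (ltW v1) v_incr v1.
have q1 : 1 <= v K / v 1%N by rewrite ler_pdivlMr ?mul1r.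
rewrite ger0_norm ?subr_ge0 //; apply: (@le_lt_trans _ _ (v K / v 1%N - 1)); last lra.
apply: (@le_trans _ _ ((v K / v 1%N - 1) * rho)).
  by rewrite mulrBl mul1r lerD2r.
by rewrite -[leRHS]mulr1 ler_wpM2l // subr_ge0.
Qed.
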